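(* Let $X$ be a finite set with distinguished point $x_0$, and let $d$ be a distance on $X$ with a realization $d=\sum_{S\subseteq X}\lambda_S\delta_S$, $\lambda_S\ge0$, which is $x_0$-adapted (i.e. $\lambda_S=0$ whenever $x_0\in S$). Let $C=\{\lambda_S\}_{S\subseteq X}$. For $\epsilon:2^X\to\{-1,+1\}$ define $$u_\epsilon(x)=\sum_{S\subseteq X,\ x\in S}\lambda_S\,\epsilon(S),\qquad x\in X .$$ If every extreme point $u$ of $\operatorname{Lip}_1^+(d)$ is of the form $u=u_\epsilon$ for some $\epsilon:2^X\to\{-1,+1\}$, then $\|\xi\|_C=\|\xi\|_{\text{Æ}}$ for every $\xi\in M_0(X)$.
   Context: For $S\subseteq X$, the cut semi-metric is $\delta_S(x,y)=1$ if exactly one of $x,y$ belongs to $S$, and $\delta_S(x,y)=0$ otherwise. $\operatorname{Lip}_1^+(d)$ is the set of functions $u:X\to\mathbb R$ with $u(x_0)=0$ and $|u(x)-u(y)|\le d(x,y)$ for all $x,y\in X$. $M_0(X)$ is the vector space of functions $\xi:X\to\mathbb R$ with $\sum_{x\in X}\xi(x)=0$. The C-norm is $\|\xi\|_C=\sum_{S\subseteq X}\lambda_S\big|\sum_{x\in S}\xi(x)\big|$. The Arens–Eells norm is $$\|\xi\|_{\text{Æ}}=\inf\Big\{\sum_{x,y\in X}|a(x,y)|\,d(x,y)\ :\ a\in\mathbb R^{X\times X},\ \xi=\sum_{x,y\in X}a(x,y)(\delta_x-\delta_y)\Big\},$$ where, with a single point as index, $\delta_x$ denotes the indicator function of $\{x\}$.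 *)

(* Defs.v *)
From HB Require Import structures.
From mathcomp Require Import all_boot all_order all_algebra.
From mathcomp Require Import all_classical all_reals.

Set Implicit Arguments.
Unset Strict Implicit.
Unset Printing Implicit Defensive.

Import Order.TTheory GRing.Theory Num.Theory.

Local Open Scope ring_scope.

(* Sets of points of X indexing cuts are finite sets, of type {set X}; sets of
   functions and of reals are classical, of type set _. Where functions on X are
   scaled they are retyped X -> R^o, with R^o being R as a module over itself, so
   that they form an lmodType R with pointwise operations. *)

Record is_distance (R : realType) (X : Type) (d : X -> X -> R) : Prop := {
  dist_ge0 : forall x y, 0 <= d x y;
  dist_eq0 : forall x y, d x y = 0 <-> x = y;
  dist_sym : forall x y, d x y = d y x;
  dist_triangle : forall x y z, d x z <= d x y + d y z
}.

Definition cut_semimetric (R : realType) (X : finType) (S : {set X})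
    (x y : X) : R :=
  ((x \in S) (+) (y \in S))%:R.

Definition realization (R : realType) (X : finType) (d : X -> X -> R)
    (lambda : {set X} -> R) : Prop :=
  (forall S, 0 <= lambda S) /\
  (forall x y, d x y = \sum_(S : {set X}) lambda S * cut_semimetric R S x y).

Definition adapted (R : realType) (X : finType) (x0 : X)
    (lambda : {set X} -> R) : Prop :=
  forall S : {set X}, x0 \in S -> lambda S = 0.

Definition Lip1 (R : realType) (X : finType) (x0 : X) (d : X -> X -> R) :
    set (X -> R) :=
  [set u | u x0 = 0 /\ forall x y, `|u x - u y| <= d x y]%classic.

Definition extreme_point (R : realType) (E : lmodType R) (K : set E) (u : E) :
    Prop :=
  K u /\
  forall (v w : E) (t : R), K v -> K w -> 0 < t < 1 ->
    u = t *: v + (1 - t) *: w -> v = u /\ w = u.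

Definition sign_valued (R : realType) (I : Type) (eps : I -> R) : Prop :=
  forall i, eps i = 1 \/ eps i = -1.

Definition u_eps (R : realType) (X : finType) (lambda eps : {set X} -> R) :
    X -> R :=
  fun x => \sum_(S : {set X} | x \in S) lambda S * eps S.

Definition M0 (R : realType) (X : finType) : set (X -> R) :=
  [set xi | \sum_(x : X) xi x = 0]%classic.

Definition C_norm (R : realType) (X : finType) (lambda : {set X} -> R)
    (xi : X -> R) : R :=
  \sum_(S : {set X}) lambda S * `|\sum_(x in S) xi x|.

Definition point_indicator (R : realType) (X : finType) (x : X) : X -> R^o :=
  fun z => (z == x)%:R.

(* inf is total, but on M0 the set below is nonempty and, since d >= 0,
   bounded below by 0, so this is the true infimum. *)
Definition AE_norm (R : realType) (X : finType) (d : X -> X -> R)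
    (xi : X -> R) : R :=
  inf [set r : R | exists a : X -> X -> R,
    (xi : X -> R^o) = \sum_(x : X) \sum_(y : X)
           a x y *: (point_indicator R x - point_indicator R y) /\
    r = \sum_(x : X) \sum_(y : X) `|a x y| * d x y]%classic.

(* Main.v *)
Require Import Defs.
From mathcomp Require Import all_boot all_order all_algebra.
From mathcomp Require Import all_classical all_reals.
From mathcomp Require Import ring lra.

(** Each cut gives [||xi||_C <= ||xi||_AE] for free. Conversely, by
    Kantorovich duality the Arens-Eells norm of [xi] is the maximum over
    1-Lipschitz functions [u] of [\sum_x xi x * u x]; the maximum is attained
    at an extreme point, hence at some [u_eps], where the pairing equals
    [\sum_S lambda S * eps S * xi(S)], which is at most the C-norm. *)

Import Order.TTheory GRing.Theory Num.Theory.

Local Open Scope ring_scope.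

Set Implicit Arguments.
Unset Strict Implicit.
Unset Printing Implicit Defensive.

(** * A finite-dimensional Hahn-Banach theorem *)

Definition sublinear (R : realType) (V : lmodType R) (p : V -> R) : Prop :=
  (forall v w, p (v + w) <= p v + p w) /\
  (forall (t : R) v, 0 <= t -> p (t *: v) <= t * p v).

Lemma sublinear0 (R : realType) (V : lmodType R) (p : V -> R) :
  sublinear p -> p 0 = 0.
Proof.
move=> [padd pscale]; have := padd 0 0; have := pscale 0 0 (lexx _).
rewrite scale0r addr0 mul0r; lra.
Qed.

Lemma sublinear_oppr (R : realType) (V : lmodType R) (p : V -> R) (v : V) :
  sublinear p -> - p (- v) <= p v.
Proof.
move=> hp; have := hp.1 v (- v); rewrite subrr sublinear0 //; lra.
Qed.

(* The largest sublinear functional below p whose value at - v is at most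
   - p v. *)
Definition directional_min (R : realType) (V : lmodType R) (p : V -> R)
    (v w : V) : R :=
  inf [set r | exists2 t : R, 0 <= t & r = p (w + t *: v) - t * p v]%classic.

Section DirectionalMin.
Variables (R : realType) (V : lmodType R) (p : V -> R) (v : V).
Hypothesis hp : sublinear p.

Lemma directional_min_lb (w : V) (t : R) :
  0 <= t -> directional_min p v w <= p (w + t *: v) - t * p v.
Proof.
move=> t0; apply: ge_inf; last by exists t.
exists (- p (- w)) => _ [s s0 ->].
(* [sublinear] gives homogeneity only as an inequality; the reverse one comes from scaling [s *: v]
   back by [s^-1]. Then [s * p v] is at most [p (w + s *: v) + p (- w)], hence the lower bound
   [- p (- w)]. *)
have sv : p (s *: v) = s * p v.
  apply/eqP; rewrite eq_le hp.2 //=.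
  move: s0; rewrite le0r => /orP[/eqP ->|s0].
    by rewrite scale0r mul0r sublinear0.
  have := hp.2 s^-1 (s *: v); rewrite scalerA mulVf ?gt_eqF // scale1r.
  rewrite invr_ge0 => /(_ (ltW s0)).
  by rewrite mulrC ler_pdivlMr // mulrC.
rewrite -sv; have := hp.1 (w + s *: v) (- w).
by rewrite addrAC subrr add0r; lra.
Qed.

Lemma directional_min_glb (w : V) (r : R) :
  (forall t : R, 0 <= t -> r <= p (w + t *: v) - t * p v) ->
  r <= directional_min p v w.
Proof.
move=> h; apply: lb_le_inf; last by move=> _ [t t0 ->]; exact: h.
by exists (p (w + 0 *: v) - 0 * p v), 0.
Qed.

Lemma directional_min_le (w : V) : directional_min p v w <= p w.
Proof.
by have := directional_min_lb w (lexx 0); rewrite scale0r addr0 mul0r subr0.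
Qed.

Lemma directional_min_oppr : directional_min p v (- v) <= - p v.
Proof.
have := directional_min_lb (- v) ler01.
by rewrite scale1r addNr sublinear0 // mul1r add0r.
Qed.

(** Shifts combine: [s] for [w1] and [t] for [w2] give the shift [s + t] for [w1 + w2], and a shift
    [s] for [w] gives [t * s] for [t *: w]. *)
Lemma directional_min_sublinear : sublinear (directional_min p v).
Proof.
split=> [w1 w2|t w].
  rewrite -lerBlDr; apply: directional_min_glb => s s0.
  rewrite lerBlDr -lerBlDl; apply: directional_min_glb => t t0.
  have := directional_min_lb (w1 + w2) (addr_ge0 s0 t0).
  have := hp.1 (w1 + s *: v) (w2 + t *: v).
  by rewrite addrACA -scalerDl mulrDl; lra.
rewrite le0r => /orP[/eqP ->|t0].
  by rewrite scale0r mul0r -(sublinear0 hp) directional_min_le.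
rewrite mulrC -ler_pdivrMr //; apply: directional_min_glb => s s0.
rewrite ler_pdivrMr //.
have ts0 : 0 <= t * s by rewrite mulr_ge0 // ltW.
have := directional_min_lb (t *: w) ts0.
rewrite -scalerA -scalerDr.
have := hp.2 t (w + s *: v) (ltW t0).
lra.
Qed.

End DirectionalMin.

(** Apply [directional_min] for each vector in turn. The bound [q (- a) <= - p a <= - q a] survives
    later decreases of the functional. As [- q (- a) <= q a] always holds, [q] is odd on the listed
    vectors, so linear on their span; a finite list replaces Zorn's lemma. *)
Lemma sublinear_linear_along (R : realType) (V : lmodType R) (p : V -> R)
    (s : seq V) :
  sublinear p ->
  exists q, [/\ sublinear q, forall v, q v <= p v &
                forall v, v \in s -> q (- v) <= - q v].
Proof.
elim: s p => [|a s IH] p hp; first by exists p.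
have [q [hq qle qs]] := IH _ (directional_min_sublinear a hp).
exists q; split=> // v.
  exact: le_trans (qle v) (directional_min_le a hp _).
rewrite inE => /orP[/eqP ->|]; last exact: qs.
apply: le_trans (qle _) _; apply: le_trans (directional_min_oppr a hp) _.
rewrite lerN2; exact: le_trans (qle a) (directional_min_le a hp _).
Qed.

Lemma sublinear_oppr_scale (R : realType) (V : lmodType R) (q : V -> R)
    (v : V) (t : R) :
  sublinear q -> q (- v) <= - q v -> q (t *: v) <= t * q v.
Proof.
move=> hq hv; have [t0|t0] := leP 0 t; first exact: hq.2.
have nt0 : 0 <= - t by rewrite oppr_ge0 ltW.
have := hq.2 (- t) (- v) nt0; rewrite scalerN scaleNr opprK.
have := ler_wpM2l nt0 hv; lra.
Qed.

Lemma sublinear_sum (R : realType) (V : lmodType R) (q : V -> R)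
    (I : finType) (F : I -> V) :
  sublinear q -> q (\sum_i F i) <= \sum_i q (F i).
Proof.
move=> hq; apply: (big_ind2 (fun v r => q v <= r)) => //.
  by rewrite sublinear0.
move=> v1 r1 v2 r2 h1 h2; exact: le_trans (hq.1 _ _) (lerD h1 h2).
Qed.

(** * Kantorovich duality *)

Section Duality.
Variables (R : realType) (X : finType).
Implicit Types (xi : X -> R^o) (a : X -> X -> R) (u : X -> R).
Local Notation delta x := (point_indicator R (x : X)).

(** The divergence of a signed transport plan that moves mass [a x y] from [y] to [x]. *)
Definition plan_div (a : X -> X -> R) : X -> R^o :=
  \sum_x \sum_y a x y *: (delta x - delta y).

Definition plan_cost (d : X -> X -> R) (a : X -> X -> R) : R :=
  \sum_x \sum_y `|a x y| * d x y.

Lemma sum_point_indicator (u : X -> R) (x : X) :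
  \sum_z delta x z * u z = u x.
Proof.
rewrite (bigD1 x) //= big1 => [|z zx]; rewrite /point_indicator.
  by rewrite eqxx mul1r addr0.
by rewrite (negbTE zx) mul0r.
Qed.

(** Summation by parts: the divergence is adjoint to taking differences. *)
Lemma pairing_plan_div a u :
  \sum_z plan_div a z * u z = \sum_x \sum_y a x y * (u x - u y).
Proof.
under eq_bigr => z _ do rewrite /plan_div fct_sumE mulr_suml.
rewrite exchange_big; apply: eq_bigr => x _ /=.
under eq_bigr => z _ do rewrite fct_sumE mulr_suml.
rewrite exchange_big; apply: eq_bigr => y _ /=.
under eq_bigr => z _ do
  rewrite -[(_ *: _) z]/(a x y * (delta x z - delta y z)) -mulrA mulrBl.
by rewrite -mulr_sumr sumrB !sum_point_indicator.
Qed.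

Lemma plan_divD a b : plan_div (fun x y => a x y + b x y) =
  plan_div a + plan_div b.
Proof.
rewrite /plan_div -big_split; apply: eq_bigr => x _ /=.
by rewrite -big_split; apply: eq_bigr => y _ /=; rewrite scalerDl.
Qed.

Lemma plan_divZ (t : R) a : plan_div (fun x y => t * a x y) = t *: plan_div a.
Proof.
rewrite /plan_div scaler_sumr; apply: eq_bigr => x _.
by rewrite scaler_sumr; apply: eq_bigr => y _; rewrite scalerA.
Qed.

Lemma sum_point_indicatorE xi : xi = \sum_x xi x *: delta x.
Proof.
apply/funext => z; rewrite fct_sumE -(sum_point_indicator xi z).
apply: eq_bigr => x _.
by rewrite -[RHS]/(xi x * delta x z) mulrC /point_indicator eq_sym.
Qed.

(** Route all mass through [x0]; what accumulates there is the total mass, which is zero. Hence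
    feasible plans exist, and the infimum in [AE_norm] is over a nonempty set. *)
Lemma plan_div_star (x0 : X) xi : \sum_x xi x = 0 ->
  plan_div (fun x y => xi x * (y == x0)%:R) = xi.
Proof.
move=> xi0; rewrite [RHS]sum_point_indicatorE /plan_div.
transitivity (\sum_x (xi x *: delta x - xi x *: delta x0)).
  apply: eq_bigr => x _; rewrite (bigD1 x0) //= big1 => [|y /negbTE ->].
    by rewrite eqxx mulr1 addr0 scalerBr.
  by rewrite mulr0 scale0r.
by rewrite sumrB -scaler_suml xi0 scale0r subr0.
Qed.

Lemma plan_div_pair (x y : X) :
  plan_div (fun z t => ((z == x) && (t == y))%:R) = delta x - delta y.
Proof.
rewrite /plan_div (bigD1 x) //= [X in _ + X]big1 => [|z /negbTE zx].
  rewrite addr0 (bigD1 y) //= big1 => [|t /negbTE ty].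
    by rewrite !eqxx scale1r addr0.
  by rewrite ty andbF scale0r.
by rewrite big1 // => t _; rewrite zx scale0r.
Qed.

Variable d : X -> X -> R.
Hypothesis d_ge0 : forall x y, 0 <= d x y.

Lemma plan_cost_ge0 a : 0 <= plan_cost d a.
Proof. by do 2!apply: sumr_ge0 => ? _; rewrite mulr_ge0. Qed.

Lemma AE_norm_le a : AE_norm d (plan_div a) <= plan_cost d a.
Proof.
apply: ge_inf; last by exists a.
by exists 0 => _ [b [_ ->]]; exact: plan_cost_ge0.
Qed.

Variable x0 : X.

Lemma le_AE_norm xi (r : R) : \sum_x xi x = 0 ->
  (forall a, xi = plan_div a -> r <= plan_cost d a) -> r <= AE_norm d xi.
Proof.
move=> xi0 h; apply: lb_le_inf; last by move=> _ [a [xia ->]]; exact: h.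
set a := fun x y => xi x * (y == x0)%:R.
by exists (plan_cost d a), a; split=> //; rewrite -(plan_div_star x0 xi0).
Qed.

Lemma sum_plan_div a : \sum_x plan_div a x = 0.
Proof.
transitivity (\sum_x plan_div a x * 1).
  by under [RHS]eq_bigr do rewrite mulr1.
rewrite pairing_plan_div big1 // => x _; rewrite big1 // => y _.
by rewrite subrr mulr0.
Qed.

Lemma AE_normD xi eta : \sum_x xi x = 0 -> \sum_x eta x = 0 ->
  AE_norm d (xi + eta : X -> R^o) <= AE_norm d xi + AE_norm d eta.
Proof.
move=> xi0 eta0; rewrite -lerBlDr; apply: le_AE_norm => // a xiE.
rewrite lerBlDr -lerBlDl; apply: le_AE_norm => // b etaE.
rewrite lerBlDr xiE etaE -plan_divD; apply: le_trans (AE_norm_le _) _.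
rewrite addrC -big_split; apply: ler_sum => x _ /=.
rewrite -big_split; apply: ler_sum => y _ /=.
by rewrite -mulrDl ler_wpM2r // ler_normD.
Qed.

Lemma AE_norm0_le : AE_norm d (0 : X -> R^o) <= 0.
Proof.
have -> : (0 : X -> R^o) = plan_div (fun _ _ => 0).
  by rewrite /plan_div big1 // => x _; rewrite big1 // => y _; rewrite scale0r.
apply: le_trans (AE_norm_le _) _; rewrite /plan_cost big1 // => x _.
by rewrite big1 // => y _; rewrite normr0 mul0r.
Qed.

Lemma AE_normZ xi (t : R) : \sum_x xi x = 0 -> 0 <= t ->
  AE_norm d (t *: xi) <= t * AE_norm d xi.
Proof.
move=> xi0; rewrite le0r => /orP[/eqP ->|t0].
  by rewrite scale0r mul0r AE_norm0_le.
rewrite mulrC -ler_pdivrMr //; apply: le_AE_norm => // a xiE.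
rewrite ler_pdivrMr // xiE -plan_divZ; apply: le_trans (AE_norm_le _) _.
rewrite mulrC mulr_sumr; apply: ler_sum => x _.
rewrite mulr_sumr; apply: ler_sum => y _.
by rewrite normrM (gtr0_norm t0) mulrA.
Qed.

(* Extends the Arens-Eells norm from M_0(X) to all functions, where the point
   indicators are available. *)
Definition recenter (f : X -> R^o) : X -> R^o :=
  f - (\sum_x f x : R) *: delta x0.

Lemma sum_recenter f : \sum_x recenter f x = 0.
Proof.
rewrite sumrB -mulr_sumr -[X in _ - _ * X](_ : 1 = _) ?mulr1 ?subrr //.
rewrite -[LHS](sum_point_indicator (fun=> 1) x0).
by apply: eq_bigr => z _; rewrite mulr1.
Qed.

Lemma recenter_id f : \sum_x f x = 0 -> recenter f = f.
Proof. by move=> f0; rewrite /recenter f0 scale0r subr0. Qed.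

Lemma recenterD f g : recenter (f + g) = recenter f + recenter g.
Proof.
rewrite /recenter; have -> : \sum_x (f + g) x = \sum_x f x + \sum_x g x.
  by rewrite -big_split.
by rewrite scalerDl opprD addrACA.
Qed.

Lemma recenterZ t f : recenter (t *: f) = t *: recenter f.
Proof.
rewrite /recenter; have -> : \sum_x (t *: f) x = t * \sum_x f x.
  by rewrite mulr_sumr.
by rewrite -scalerA scalerBr.
Qed.

Lemma recenter_point : recenter (delta x0) = 0.
Proof.
rewrite /recenter; have -> : \sum_x delta x0 x = 1; last first.
  by rewrite scale1r subrr.
rewrite -[RHS](sum_point_indicator (fun=> 1) x0).
by apply: eq_bigr => z _; rewrite mulr1.
Qed.

Lemma sublinear_AE_recenter : sublinear (fun f => AE_norm d (recenter f)).
Proof.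
split=> [f g|t f t0].
  by rewrite recenterD AE_normD ?sum_recenter.
by rewrite recenterZ AE_normZ ?sum_recenter.
Qed.

Lemma AE_norm_point_sub x y : AE_norm d (delta x - delta y : X -> R^o) <= d x y.
Proof.
rewrite -plan_div_pair; apply: le_trans (AE_norm_le _) _.
rewrite /plan_cost (bigD1 x) //= [X in _ + X]big1 => [|z /negbTE zx].
  rewrite addr0 (bigD1 y) //= big1 => [|t /negbTE ty].
    by rewrite !eqxx normr1 mul1r addr0.
  by rewrite ty andbF normr0 mul0r.
by rewrite big1 // => t _; rewrite zx normr0 mul0r.
Qed.

Hypothesis d_sym : forall x y, d x y = d y x.

Lemma Lip1_le u : u x0 = 0 -> (forall x y, u x - u y <= d x y) -> Lip1 x0 d u.
Proof.
move=> u0 ud; split=> // x y; rewrite ler_norml ud andbT lerNl opprB d_sym.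
exact: ud.
Qed.

Lemma Lip1_sub_le u x y : Lip1 x0 d u -> u x - u y <= d x y.
Proof. by move=> [_ ud]; exact: le_trans (ler_norm _) (ud x y). Qed.

Lemma pairing_le_AE_norm xi u : \sum_x xi x = 0 -> Lip1 x0 d u ->
  \sum_x xi x * u x <= AE_norm d xi.
Proof.
move=> xi0 [_ ud]; apply: le_AE_norm => // a ->; rewrite pairing_plan_div.
apply: ler_sum => x _; apply: ler_sum => y _.
by rewrite (le_trans (ler_norm _)) // normrM ler_wpM2l.
Qed.

(** Hahn-Banach for the recentered norm [p]: a functional [q] below [p] that keeps the value at [xi]
    and is linear along point indicators yields the potential [q (delta x)]. *)
Lemma Kantorovich_duality xi : \sum_x xi x = 0 ->
  exists2 u, Lip1 x0 d u & AE_norm d xi = \sum_x xi x * u x.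
Proof.
move=> xi0; pose p f := AE_norm d (recenter f).
have hp : sublinear p := sublinear_AE_recenter.
(* Minimizing along [xi] first forces [q (- xi) <= - p xi], hence [p xi <= q xi]. *)
have [q [hq qp qs]] := sublinear_linear_along
  [seq delta x | x <- enum X] (directional_min_sublinear xi hp).
have qdelta x : q (- delta x) <= - q (delta x).
  by apply: qs; rewrite map_f ?mem_enum.
have qxi : p xi <= q xi.
  have := sublinear_oppr xi hq; have := qp (- xi).
  have := directional_min_oppr xi hp; lra.
have {}qp f : q f <= p f := le_trans (qp f) (directional_min_le xi hp f).
(* Recentering kills [delta x0], so [q] vanishes there; the Lipschitz bound comes from the cost of
   the plan moving one unit from [y] to [x]. *)
have uLip : Lip1 x0 d (fun x => q (delta x)).
  apply: Lip1_le => [|x y].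
    apply/eqP; rewrite eq_le; apply/andP; split.
      by apply: le_trans (qp _) _; rewrite /p recenter_point AE_norm0_le.
    have := qp (- delta x0); rewrite /p -scaleN1r recenterZ recenter_point.
    rewrite scaler0.
    have := sublinear_oppr (delta x0) hq; have := AE_norm0_le.
    rewrite scaleN1r; lra.
  have := hq.1 (delta x - delta y) (delta y); rewrite subrK.
  have := qp (delta x - delta y); rewrite /p recenter_id.
    have := AE_norm_point_sub x y; lra.
  by rewrite -plan_div_pair sum_plan_div.
exists (fun x => q (delta x)) => //; apply/eqP; rewrite eq_le.
rewrite pairing_le_AE_norm // andbT -[xi in AE_norm _ xi]recenter_id //.
apply: le_trans qxi _; rewrite [X in q X]sum_point_indicatorE.
apply: le_trans (sublinear_sum _ hq) _; apply: ler_sum => x _.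
exact: sublinear_oppr_scale.
Qed.

(** * Maximizers at extreme points *)

Definition slack_pairs (u : X -> R) : {set X * X} :=
  [set z | u z.1 - u z.2 != d z.1 z.2].

Lemma not_extreme_point u : Lip1 x0 d u ->
  ~ extreme_point (E := X -> R^o) (Lip1 x0 d) u ->
  exists v w : X -> R, exists t : R,
    [/\ Lip1 x0 d v, Lip1 x0 d w, 0 < t < 1,
        forall x, u x = t * v x + (1 - t) * w x &
        exists x, v x != w x].
Proof.
move=> hu nex; apply: contrapT => hno; apply: nex; split=> // v w t hv hw ht uE.
have uEx x : u x = t * v x + (1 - t) * w x by rewrite uE.
have vw : v = w.
  apply/funext => x; apply/eqP/negPn/negP => vwx; apply: hno.
  by exists v, w, t; split=> //; exists x.
suff vu : v = u by rewrite -vw.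
by apply/funext => x; rewrite uEx -vw -mulrDl addrC subrK mul1r.
Qed.

(** A ratio test: move along [h] until the first pair on which [h] increases becomes tight. That
    pair was slack because [h] separates it, while tight pairs stay tight because [h] does not
    separate them. *)
Lemma extend_to_tight u h : Lip1 x0 d u -> h x0 = 0 -> (exists x, h x != 0) ->
  (forall x y, u x - u y = d x y -> h x = h y) ->
  exists s : R, Lip1 x0 d (fun x => u x + s * h x) /\
    slack_pairs (fun x => u x + s * h x) \proper slack_pairs u.
Proof.
move=> hu h0 [z hz] htight.
have [z0 z0P] : exists z0 : X * X, 0 < h z0.1 - h z0.2.
  have [hz0|hz0] := ltP 0 (h z); first by exists (z, x0); rewrite h0 subr0.
  by exists (x0, z); rewrite h0 sub0r oppr_gt0 lt_neqAle hz.
pose P (z : X * X) := 0 < h z.1 - h z.2.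
(* The step length at which the pair [z] becomes tight. *)
pose F (z : X * X) := (d z.1 z.2 - (u z.1 - u z.2)) / (h z.1 - h z.2).
have : exists2 m, P m & forall z, P z -> F m <= F z.
  by case: (@arg_minP _ _ _ z0 P F z0P) => m Pm mF; exists m.
move=> [m Pm mF]; exists (F m).
have Fm0 : 0 <= F m.
  by apply: divr_ge0 (ltW Pm); rewrite subr_ge0 Lip1_sub_le.
split.
  apply: Lip1_le; first by rewrite h0 mulr0 addr0 hu.1.
  move=> x y; have uxy := Lip1_sub_le x y hu.
  have [hxy|hxy] := ltP 0 (h x - h y).
    by have := mF (x, y) hxy; rewrite {2}/F ler_pdivlMr //=; lra.
  have := ler_wpM2l Fm0 hxy; lra.
apply/properP; split.
  apply/fintype.subsetP => -[x y]; rewrite !inE /=; apply: contraNN => /eqP uxy.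
  by rewrite (htight x y uxy) opprD addrACA subrr addr0 uxy.
exists m; rewrite inE.
  apply/eqP => um; move: Pm; rewrite /P (htight _ _ um) subrr ltxx //.
rewrite negbK; apply/eqP.
have : F m * (h m.1 - h m.2) = d m.1 m.2 - (u m.1 - u m.2).
  by rewrite /F mulfVK // gt_eqF.
lra.
Qed.

(* A non-extreme maximizer lies inside a segment on which the objective is
   constant and every tight pair stays tight; moving along it until another
   pair becomes tight decreases the number of slack pairs. *)
Lemma extreme_maximizer xi u : Lip1 x0 d u ->
  (forall v, Lip1 x0 d v -> \sum_x xi x * v x <= \sum_x xi x * u x) ->
  exists2 v, extreme_point (E := X -> R^o) (Lip1 x0 d) v &
    \sum_x xi x * v x = \sum_x xi x * u x.
Proof.
move: {2}#|slack_pairs u|.+1 (ltnSn #|slack_pairs u|) => n.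
elim: n u => // n IH u un hu umax.
have [ex|] := pselect (extreme_point (E := X -> R^o) (Lip1 x0 d) u).
  by exists u.
move=> /(not_extreme_point hu)[v [w [t [hv hw /andP[t0 t1] uE [z vwz]]]]].
pose h x := v x - w x.
(* The maximal value at [u] is a proper average of the values at [v] and [w], neither of which
   exceeds it, so the two agree. *)
have sumh : \sum_x xi x * h x = 0.
  have := umax v hv; have := umax w hw.
  have -> : \sum_x xi x * u x = t * (\sum_x xi x * v x) +
      (1 - t) * \sum_x xi x * w x.
    rewrite !mulr_sumr -big_split; apply: eq_bigr => x _ /=; rewrite uE; ring.
  have -> : \sum_x xi x * h x = \sum_x xi x * v x - \sum_x xi x * w x.
    by rewrite -sumrB; apply: eq_bigr => x _; rewrite mulrBr.
  nra.
have h0 : h x0 = 0 by rewrite /h hv.1 hw.1 subr0.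
have hz : exists x, h x != 0 by exists z; rewrite subr_eq0.
(* Likewise, if the average of two differences bounded by [d x y] equals [d x y], both differences
   equal it. *)
have htight x y : u x - u y = d x y -> h x = h y.
  rewrite !uE /h; have := Lip1_sub_le x y hv; have := Lip1_sub_le x y hw.
  nra.
have [s [hs sprop]] := extend_to_tight hu h0 hz htight.
have sumE : \sum_x xi x * (u x + s * h x) = \sum_x xi x * u x.
  transitivity (\sum_x xi x * u x + s * \sum_x xi x * h x); last first.
    by rewrite sumh mulr0 addr0.
  by rewrite mulr_sumr -big_split; apply: eq_bigr => x _ /=; ring.
have [||v' v'ex v'E] := IH _ _ hs.
- exact: leq_trans (proper_card sprop) un.
- by move=> f hf; rewrite sumE umax.
- by exists v' => //; rewrite v'E sumE.
Qed.

End Duality.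

(** * Comparison with the C-norm *)

(** The cost splits over cuts. For one cut, pair the divergence with the indicator of [S]: its
    differences have absolute value [cut_semimetric R S x y]. *)
Lemma C_norm_le_plan_cost (R : realType) (X : finType) (d : X -> X -> R)
    (lambda : {set X} -> R) (a : X -> X -> R) : realization d lambda ->
  C_norm lambda (plan_div a) <= plan_cost d a.
Proof.
move=> [l0 dE]; rewrite /C_norm /plan_cost.
have -> : \sum_x \sum_y `|a x y| * d x y = \sum_(S : {set X})
    lambda S * \sum_x \sum_y `|a x y| * cut_semimetric R S x y.
  under [RHS]eq_bigr do rewrite mulr_sumr.
  rewrite [RHS]exchange_big; apply: eq_bigr => x _ /=.
  under [RHS]eq_bigr do rewrite mulr_sumr.
  rewrite [RHS]exchange_big; apply: eq_bigr => y _ /=.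
  by rewrite dE mulr_sumr; apply: eq_bigr => S _; rewrite mulrCA.
apply: ler_sum => S _; apply: ler_wpM2l => //.
have -> : \sum_(x in S) plan_div a x = \sum_x plan_div a x * (x \in S)%:R.
  rewrite big_mkcond; apply: eq_bigr => x _.
  by case: (x \in S); rewrite ?mulr1 ?mulr0.
rewrite pairing_plan_div; apply: le_trans (ler_norm_sum _ _ _) _.
apply: ler_sum => x _; apply: le_trans (ler_norm_sum _ _ _) _.
apply: ler_sum => y _; rewrite normrM ler_wpM2l // /cut_semimetric.
by case: (x \in S); case: (y \in S);
  rewrite ?subrr ?subr0 ?sub0r ?normrN ?normr1 ?normr0.
Qed.

Lemma pairing_u_eps_le_C_norm (R : realType) (X : finType)
    (lambda eps : {set X} -> R) (xi : X -> R) :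
  (forall S, 0 <= lambda S) -> sign_valued eps ->
  \sum_x xi x * u_eps lambda eps x <= C_norm lambda xi.
Proof.
move=> l0 heps.
have -> : \sum_x xi x * u_eps lambda eps x =
    \sum_(S : {set X}) lambda S * (eps S * \sum_(x in S) xi x).
  under eq_bigr do rewrite /u_eps mulr_sumr.
  rewrite (exchange_big_dep xpredT) //=; apply: eq_bigr => S _.
  by rewrite !mulr_sumr; apply: eq_bigr => x _; ring.
apply: ler_sum => S _; apply: ler_wpM2l => //.
apply: le_trans (ler_norm _) _.
by rewrite normrM; case: (heps S) => ->; rewrite ?normrN normr1 mul1r.
Qed.

Theorem theorem9 (R : realType) (X : finType) (x0 : X) (d : X -> X -> R)
    (lambda : {set X} -> R)
    (hd : is_distance d)
    (hreal : realization d lambda)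
    (hadapted : adapted x0 lambda)
    (hext : forall u : X -> R, extreme_point (E := X -> R^o) (Lip1 x0 d) u ->
       exists eps : {set X} -> R, sign_valued eps /\ u = u_eps lambda eps)
    (xi : X -> R) (hxi : M0 xi) :
  C_norm lambda xi = AE_norm d xi.
Proof.
have d0 := dist_ge0 hd; have dsym := dist_sym hd.
apply/eqP; rewrite eq_le; apply/andP; split.
  by apply: (le_AE_norm x0 hxi) => a ->; exact: C_norm_le_plan_cost.
have [u hu uE] := Kantorovich_duality d0 x0 dsym hxi.
(* The potential [u] attains [AE_norm d xi], which bounds every pairing with a 1-Lipschitz function,
   so [u] is a maximizer and can be traded for an extreme one. *)
have [v hv|v /hext[eps [heps ->]] vE] := extreme_maximizer (xi := xi) dsym hu.
  by rewrite -uE; exact: pairing_le_AE_norm hxi hv.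
by rewrite uE -vE; apply: pairing_u_eps_le_C_norm => //; exact: hreal.1.
Qed.
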